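(* Let $f\colon\mathcal{O}_1\to\mathcal{O}_2$ be a smooth map between orbifolds and let $\mathcal{Q}\subset\mathcal{O}_2$ be a full suborbifold such that $f$ is transverse to $\mathcal{Q}$. Then $\mathcal{P}:=f^{-1}(\mathcal{Q})$ is empty or a full suborbifold of $\mathcal{O}_1$ of dimension $\dim\mathcal{O}_1-(\dim\mathcal{O}_2-\dim\mathcal{Q})$.
   Context: Manifolds are Hausdorff, second countable, smooth, without boundary and of constant finite dimension (not necessarily connected). ''Submanifold'' means embedded submanifold. Full $H$-submanifolds: for a Lie group $G$ (possibly finite), a $G$-manifold is a manifold with a smooth left $G$-action. If $H\subset G$ is a closed subgroup and $M$ is a $G$-manifold, a full $H$-submanifold of $M$ is an $H$-invariant submanifold $N\subset M$ such that whenever $g\in G$ and $x\in N$ satisfy $gx\in N$, then $g\in H$. Orbifolds: let $X$ be a second countable Hausdorff space. An $n$-dimensional orbifold chart on $X$ is a quadruple $(U,\widetilde{U}/\Gamma,\pi)$ where $U\subset X$ is open, $\Gamma$ is a finite group, $\widetilde{U}$ is a connected $n$-dimensional manifold with a smooth effective $\Gamma$-action, and $\pi\colon\widetilde{U}\to U$ is a continuous $\Gamma$-invariant map inducing a homeomorphism $\widetilde{U}/\Gamma\to U$. An injection from a chart $(V,\widetilde{V}/\Delta,\phi)$ to a chart $(U,\widetilde{U}/\Gamma,\pi)$ with $V\subset U$ is a smooth embedding $\lambda\colon\widetilde{V}\to\widetilde{U}$ with $\pi\circ\lambda=\phi$. Two charts $(U_i,\widetilde{U}_i/\Gamma_i,\pi_i)$,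 $i=1,2$, are compatible in $p$ if there is a chart $(V,\widetilde{V}/\Delta,\phi)$ with $p\in V\subset U_1\cap U_2$ and injections from it into both charts. An $n$-dimensional orbifold atlas on $X$ is a collection of $n$-dimensional orbifold charts whose sets $U_\alpha$ cover $X$ and such that any two of them are compatible in every point of $U_\alpha\cap U_\beta$; every atlas is contained in a unique maximal atlas. An (effective) orbifold is a space $X$ together with a maximal orbifold atlas; a chart of (or on) the orbifold is an element of this maximal atlas. The orbifold and its underlying space are denoted by the same symbol. The isotropy $\mathrm{Iso}(p)$ of a point $p$ of an orbifold is the (well-defined) isomorphism class of the stabilizer $\Gamma_{\tilde{p}}$ for any chart $(U,\widetilde{U}/\Gamma,\pi)$ with $p\in U$ and any $\tilde{p}\in\pi^{-1}(p)$. Full suborbifolds: a subset $\mathcal{P}\subset\mathcal{O}$ is a full $k$-dimensional suborbifold ($0\le k\le\dim\mathcal{O}$) if for every $p\in\mathcal{P}$ there are a chart $(U,\widetilde{U}/\Gamma,\pi)$ of $\mathcal{O}$, a subgroup $\Delta\subset\Gamma$ and a $k$-dimensional full $\Delta$-submanifold $\widetilde{V}\subset\widetilde{U}$ such that $\pi(\widetilde{V})$ is an open neighborhood of $p$ in $\mathcal{P}$. Smooth maps: a continuous map $f\colon\mathcal{O}_1\to\mathcal{O}_2$ between orbifolds is smooth if for every $p\in\mathcal{O}_1$ there are charts $(U_i,\widetilde{U}_i/\Gamma_i,\pi_i)$ of $\mathcal{O}_i$, $i=1,2$, around $p$ and $f(p)$, respectively, a smooth map $\widetilde{f}\colon\widetilde{U}_1\to\widetilde{U}_2$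 and a homomorphism $\Theta\colon\Gamma_1\to\Gamma_2$ such that $f\circ\pi_1=\pi_2\circ\widetilde{f}$ and $\widetilde{f}(\gamma x)=\Theta(\gamma)\widetilde{f}(x)$ for all $\gamma\in\Gamma_1$, $x\in\widetilde{U}_1$. Transversality: let $f\colon\mathcal{O}_1\to\mathcal{O}_2$ be smooth and let $\mathcal{Q}\subset\mathcal{O}_2$ be a $k$-dimensional full suborbifold. $f$ is transverse to $\mathcal{Q}$ if for every $p\in f^{-1}(\mathcal{Q})$ there are: a chart $(U_1,\widetilde{U}_1/\Gamma_1,\pi_1)$ on $\mathcal{O}_1$ around $p$; a chart $(U_2,\widetilde{U}_2/\Gamma_2,\pi_2)$ on $\mathcal{O}_2$ around $f(p)$ such that $\Gamma_2\simeq\mathrm{Iso}(f(p))$ and $f(U_1)\subset U_2$; a $k$-dimensional $\Gamma_2$-invariant submanifold $\widetilde{V}$ of $\widetilde{U}_2$ such that $\pi_2(\widetilde{V})$ is an open neighborhood of $f(p)$ in $\mathcal{Q}$; a smooth map $\widetilde{f}\colon\widetilde{U}_1\to\widetilde{U}_2$ transverse to $\widetilde{V}$ (in the usual sense for manifolds) such that $\pi_2\circ\widetilde{f}=f\circ\pi_1$; and a homomorphism $\Theta\colon\Gamma_1\to\Gamma_2$ such that $\widetilde{f}(\gamma x)=\Theta(\gamma)\widetilde{f}(x)$ for every $\gamma\in\Gamma_1$, $x\in\widetilde{U}_1$. *)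

(* Defs.v *)
From HB Require Import structures.
From mathcomp Require Import all_boot all_order all_algebra all_fingroup.
From mathcomp Require Import all_classical all_reals all_analysis.

Set Implicit Arguments.
Unset Strict Implicit.
Unset Printing Implicit Defensive.

Import Order.TTheory GRing.Theory Num.Theory.
Import numFieldNormedType.Exports.

Local Open Scope classical_set_scope.
Local Open Scope quotient_scope.
Local Open Scope ring_scope.

(* Meant for an open set [A]: the values of [f] outside [A] are then
   irrelevant. *)
Fixpoint Ck (R : realType) (V W : normedModType R) (k : nat) (A : set V)
    (f : V -> W) : Prop :=
  if k is k'.+1 then
    (forall x, A x -> differentiable f x) /\ (forall v : V, Ck k' A ('D_v f))
  else forall x, A x -> {for x, continuous f}.

Definition Cinfty (R : realType) (V W : normedModType R) (A : set V)
    (f : V -> W) : Prop :=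
  forall k, Ck k A f.

(* [h] restricts to a homeomorphism from the subspace [A] onto the subspace
   [B]; the last clause is the continuity of the inverse. *)
Definition homeomorphism_on (S T : topologicalType) (A : set S) (h : S -> T)
    (B : set T) : Prop :=
  [/\ {within A, continuous h}, {in A &, injective h}, h @` A = B &
      forall O, open O -> exists2 O', open O' & h @` (A `&` O) = B `&` O'].

Definition topological_embedding (S T : topologicalType) (h : S -> T) : Prop :=
  homeomorphism_on setT h (range h).

Definition open_neighborhood_in (X : topologicalType) (Q N : set X) (p : X) :
    Prop :=
  N p /\ exists2 W, open W & N = Q `&` W.

(* Charts are total functions of which only the values on [cdom] matter. *)
Record chart (R : realType) (X : topologicalType) (n : nat) := Chart {
  cdom : set X;
  coord :> X -> 'rV[R]_n;
  cdom_open : open cdom;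
  cimage_open : open (coord @` cdom);
  coord_homeo : homeomorphism_on cdom coord (coord @` cdom)
}.

(* [g] agrees with c2 o f o c1^-1 where the latter is defined. *)
Definition local_rep (R : realType) (X Y : topologicalType) (n m : nat)
    (c1 : chart R X n) (c2 : chart R Y m) (f : X -> Y)
    (g : 'rV[R]_n -> 'rV[R]_m) : Prop :=
  forall x, cdom c1 x -> cdom c2 (f x) -> g (c1 x) = c2 (f x).

Definition smooth_in_charts (R : realType) (X Y : topologicalType) (n m : nat)
    (c1 : chart R X n) (c2 : chart R Y m) (f : X -> Y) : Prop :=
  exists2 g : 'rV[R]_n -> 'rV[R]_m,
    Cinfty (c1 @` (cdom c1 `&` f @^-1` cdom c2)) g & local_rep c1 c2 f g.

Definition chart_compatible (R : realType) (X : topologicalType) (n : nat)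
    (c1 c2 : chart R X n) : Prop :=
  smooth_in_charts c1 c2 id /\ smooth_in_charts c2 c1 id.

Record manifold (R : realType) (n : nat) := Manifold {
  mspace :> topologicalType;
  mspace_hausdorff : hausdorff_space mspace;
  mspace_second_countable : @second_countable mspace;
  atlas : set (chart R mspace n);
  atlas_cover : forall x, exists2 c, atlas c & cdom c x;
  atlas_compatible : forall c1 c2, atlas c1 -> atlas c2 ->
    chart_compatible c1 c2;
  atlas_maximal : forall c, (forall c', atlas c' -> chart_compatible c c') ->
    atlas c
}.

Definition smooth_map (R : realType) (n m : nat) (M : manifold R n)
    (N : manifold R m) (f : M -> N) : Prop :=
  continuous f /\
  forall c1 c2, atlas c1 -> atlas c2 -> smooth_in_charts c1 c2 f.

Definition immersion (R : realType) (n m : nat) (M : manifold R n)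
    (N : manifold R m) (f : M -> N) : Prop :=
  forall x c1 c2 g, atlas c1 -> atlas c2 -> cdom c1 x -> cdom c2 (f x) ->
    local_rep c1 c2 f g -> injective ('d g (c1 x)).

Definition smooth_embedding (R : realType) (n m : nat) (M : manifold R n)
    (N : manifold R m) (f : M -> N) : Prop :=
  [/\ smooth_map f, immersion f & topological_embedding f].

(* Embedded submanifolds, through slice charts: in the chart [c] the set [S]
   is the intersection of the chart image with R^k x 0. *)
Definition submanifold (R : realType) (n : nat) (M : manifold R n) (k : nat)
    (S : set M) : Prop :=
  (k <= n)%N /\
  forall p, S p -> exists c, [/\ atlas c, cdom c p &
    forall x, cdom c x ->
      (S x <-> forall i : 'I_n, (k <= i)%N -> c x ord0 i = 0)].

(* The tangent space of [S] at [y], read in the chart [c]: velocities at 0 of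
   the curves that are smooth and stay in [S] near 0. *)
Definition tangent_in_chart (R : realType) (n : nat) (M : manifold R n)
    (S : set M) (c : chart R M n) (y : M) : set 'rV[R]_n :=
  [set v | exists (gamma : R -> M) (e : R),
    [/\ 0 < e, gamma 0 = y,
        forall t, ball 0 e t -> cdom c (gamma t) /\ S (gamma t),
        Cinfty (ball (0 : R) e) (c \o gamma) &
        v = derive1 (c \o gamma) 0]].

(* df(T_x M) + T_{f x} V = T_{f x} N, read in charts. *)
Definition transverse (R : realType) (n m : nat) (M : manifold R n)
    (N : manifold R m) (f : M -> N) (V : set N) : Prop :=
  forall x c1 c2 g, V (f x) ->
    atlas c1 -> atlas c2 -> cdom c1 x -> cdom c2 (f x) ->
    local_rep c1 c2 f g ->
    [set u + v | u in range ('d g (c1 x)) & v in tangent_in_chart V c2 (f x)]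
      = [set: 'rV[R]_m].

Record smooth_action (R : realType) (n : nat) (G : finGroupType)
    (M : manifold R n) := SmoothAction {
  act_fun :> G -> M -> M;
  act_fun1 : forall x, act_fun 1%g x = x;
  act_funM : forall g h x, act_fun (g * h)%g x = act_fun g (act_fun h x);
  act_smooth : forall g, smooth_map (act_fun g)
}.

Definition effective (R : realType) (n : nat) (G : finGroupType)
    (M : manifold R n) (a : smooth_action G M) : Prop :=
  forall g, (forall x, a g x = x) -> g = 1%g.

Definition stab (R : realType) (n : nat) (G : finGroupType)
    (M : manifold R n) (a : smooth_action G M) (x : M) : {set G} :=
  [set g | a g x == x]%SET.

Section OrbitSpace.
Context (R : realType) (n : nat) (G : finGroupType) (M : manifold R n).
Variable a : smooth_action G M.

Definition orbit_rel : rel M := fun x y => [exists g, a g x == y].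

Lemma orbit_rel_equiv : equiv_class_of orbit_rel.
Proof.
split.
- by move=> x; apply/existsP; exists 1%g; rewrite act_fun1.
- have sym x y : orbit_rel x y -> orbit_rel y x.
    move=> /existsP[g /eqP <-]; apply/existsP; exists g^-1%g.
    by rewrite -act_funM mulVg act_fun1.
  by move=> x y; apply/idP/idP; exact: sym.
- move=> y x z /existsP[g /eqP <-] /existsP[h /eqP <-].
  by apply/existsP; exists (h * g)%g; rewrite act_funM.
Qed.

Definition orbit_equiv : equiv_rel M := EquivRelPack orbit_rel_equiv.

Definition orbit_space : topologicalType :=
  quotient_topology {eq_quot orbit_equiv}.

Definition orbit_proj (x : M) : orbit_space := \pi_{eq_quot orbit_equiv} x.

End OrbitSpace.

Record orb_chart (R : realType) (X : topologicalType) (n : nat) := OrbChart {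
  odom : set X;
  odom_open : open odom;
  ogroup : finGroupType;
  ocover : manifold R n;
  ocover_connected : connected [set: ocover];
  oact : smooth_action ogroup ocover;
  oact_effective : effective oact;
  oproj :> ocover -> X;
  oproj_continuous : continuous oproj;
  oproj_invariant : forall g x, oproj (oact g x) = oproj x;
  oproj_homeo : exists2 h : orbit_space oact -> X,
    oproj = h \o orbit_proj oact & homeomorphism_on setT h odom
}.

Definition injection (R : realType) (X : topologicalType) (n : nat)
    (d c : orb_chart R X n) (l : ocover d -> ocover c) : Prop :=
  [/\ odom d `<=` odom c, smooth_embedding l & c \o l = d].

Definition compatible_at (R : realType) (X : topologicalType) (n : nat)
    (c1 c2 : orb_chart R X n) (p : X) : Prop :=
  exists d : orb_chart R X n,
    [/\ odom d p, odom d `<=` odom c1 `&` odom c2,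
        exists l : ocover d -> ocover c1, injection l &
        exists l : ocover d -> ocover c2, injection l].

Definition is_orb_atlas (R : realType) (X : topologicalType) (n : nat)
    (A : orb_chart R X n -> Prop) : Prop :=
  (forall p, exists2 c, A c & odom c p) /\
  forall c1 c2, A c1 -> A c2 ->
    forall p, odom c1 p -> odom c2 p -> compatible_at c1 c2 p.

Record orbifold (R : realType) (n : nat) := Orbifold {
  ospace :> topologicalType;
  ospace_hausdorff : hausdorff_space ospace;
  ospace_second_countable : @second_countable ospace;
  ocharts : orb_chart R ospace n -> Prop;
  ocharts_atlas : is_orb_atlas ocharts;
  ocharts_maximal : forall A, is_orb_atlas A ->
    (forall c, ocharts c -> A c) -> forall c, A c -> ocharts c
}.

(* The class Iso(p), as the predicate of membership in it. *)
Definition isotropy (R : realType) (n : nat) (O : orbifold R n) (p : O)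
    (G : finGroupType) : Prop :=
  exists (c : orb_chart R O n) (x : ocover c),
    [/\ ocharts c, c x = p & isog [set: G]%SET (stab (oact c) x)].

Definition full_submanifold (R : realType) (n : nat) (G : finGroupType)
    (M : manifold R n) (a : smooth_action G M) (H : {group G}) (k : nat)
    (N : set M) : Prop :=
  [/\ submanifold k N,
      forall g x, g \in H -> N x -> N (a g x) &
      forall g x, N x -> N (a g x) -> g \in H].

Definition full_suborbifold (R : realType) (n : nat) (O : orbifold R n)
    (k : nat) (P : set O) : Prop :=
  (k <= n)%N /\
  forall p, P p ->
    exists (c : orb_chart R O n) (D : {group ogroup c}) (V : set (ocover c)),
      [/\ ocharts c, full_submanifold (oact c) D k V &
          open_neighborhood_in P (c @` V) p].

Definition orb_smooth (R : realType) (n1 n2 : nat) (O1 : orbifold R n1)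
    (O2 : orbifold R n2) (f : O1 -> O2) : Prop :=
  continuous f /\
  forall p, exists (c1 : orb_chart R O1 n1) (c2 : orb_chart R O2 n2)
      (F : ocover c1 -> ocover c2)
      (Theta : {morphism [set: ogroup c1]%SET >-> ogroup c2}),
    [/\ ocharts c1 /\ odom c1 p, ocharts c2 /\ odom c2 (f p), smooth_map F,
        f \o c1 = c2 \o F &
        forall g x, F (oact c1 g x) = oact c2 (Theta g) (F x)].

Definition orb_transverse (R : realType) (n1 n2 : nat) (O1 : orbifold R n1)
    (O2 : orbifold R n2) (f : O1 -> O2) (k : nat) (Q : set O2) : Prop :=
  forall p, Q (f p) ->
    exists (c1 : orb_chart R O1 n1) (c2 : orb_chart R O2 n2)
      (V : set (ocover c2)) (F : ocover c1 -> ocover c2)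
      (Theta : {morphism [set: ogroup c1]%SET >-> ogroup c2}),
    [/\ ocharts c1 /\ odom c1 p,
        [/\ ocharts c2, odom c2 (f p), isotropy (f p) (ogroup c2) &
            f @` odom c1 `<=` odom c2],
        [/\ submanifold k V, forall g x, V x -> V (oact c2 g x) &
            open_neighborhood_in Q (c2 @` V) (f p)],
        [/\ smooth_map F, transverse F V & c2 \o F = f \o c1] &
        forall g x, F (oact c1 g x) = oact c2 (Theta g) (F x)].

(* Main.v *)
Require Import Defs.
From HB Require Import structures.
From mathcomp Require Import all_boot all_order all_algebra all_fingroup.
From mathcomp Require Import all_classical all_reals all_analysis ring lra.

(** In the charts given by transversality, [f] lifts to a [Theta]-equivariant
    map [F] transverse to an invariant submanifold [V], and the invariance of
    [V] makes [F^-1 V] the full preimage of the part of [f^-1 Q] lying in the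
    chart.  Being invariant under the whole chart group, [F^-1 V] is a full
    submanifold for that group as soon as it is a submanifold, so everything
    reduces to the preimage theorem for manifolds.  There, the last coordinates
    [h] of [F] in a slice chart of [V] form a submersion; completing [h] by a
    linear map gives a local diffeomorphism by the inverse function theorem
    (a contraction argument), and composing it with a chart of the source gives
    a slice chart of [F^-1 V]. *)

Set Implicit Arguments.
Unset Strict Implicit.
Unset Printing Implicit Defensive.

Import Order.TTheory GRing.Theory Num.Theory.
Import numFieldNormedType.Exports.

Local Open Scope classical_set_scope.
Local Open Scope ring_scope.

(** * Calculus of C^k maps *)

Section Differentiability.
Context {R : realType} {V W : normedModType R}.
Implicit Types (f g : V -> W) (a v : V).

Lemma differentiable_eps f a (e : R) : differentiable f a -> 0 < e ->
  \forall h \near 0, `|f (h + a) - f a - 'd f a h| <= e * `|h|.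
Proof.
move=> /diff_locally /eqaddoP /(_ e) /[apply]; apply: filterS => h /=.
by rewrite !fctE /= opprD addrA.
Qed.

(** A first-order expansion determines the differential, so a continuous linear candidate passing
    the epsilon test yields both differentiability and the value of ['d f a]. *)
Lemma eps_differentiable f a (df : {linear V -> W}) : continuous df ->
  (forall e : R, 0 < e ->
    \forall h \near 0, `|f (h + a) - f a - df h| <= e * `|h|) ->
  differentiable f a /\ 'd f a = df :> (V -> W).
Proof.
move=> cdf dfP.
have H : f \o shift a = cst (f a) + df +o_ 0 id.
  apply/eqaddoP => e /dfP; apply: filterS => h /=.
  by rewrite !fctE /= opprD addrA.
have E := diff_unique cdf H.
by split => //; apply/diff_locallyP; rewrite E.
Qed.

Lemma near_eq_differentiable f g a :
  (\forall x \near a, f x = g x) -> differentiable f a -> differentiable g a.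
Proof.
move=> fg fa; apply: (proj1 (@eps_differentiable g a ('d f a) _ _)).
  exact: diff_continuous.
move=> e e0.
have fg0 : \forall h \near 0, f (h + a) = g (h + a).
  by move: fg; rewrite (near_shift 0 a)/= subr0.
near=> h; rewrite -(nbhs_singleton fg) -(near fg0 h)//.
by near: h; exact: differentiable_eps.
Unshelve. all: by end_near. Qed.

End Differentiability.

(** * Closure properties of C^k maps *)

Section Ck.
Context {R : realType}.

Section general.
Context {V W : normedModType R}.
Implicit Types (A B : set V) (f g : V -> W).

Lemma Ck_continuous k A f x : Ck k A f -> A x -> {for x, continuous f}.
Proof.
case: k => [|k] /=; first by apply.
by move=> [df _] Ax; exact/differentiable_continuous/df.
Qed.

Lemma Ck_sub k A B f : A `<=` B -> Ck k B f -> Ck k A f.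
Proof.
move=> AB; elim: k f => [|k IH] f /=; first by move=> cf x /AB /cf.
by move=> [df Df]; split=> [x /AB /df //|v]; exact: IH.
Qed.

Lemma CkW k A f : Ck k.+1 A f -> Ck k A f.
Proof.
elim: k f => [|k IH] f.
  by move=> [df _] x /df; exact: differentiable_continuous.
by move=> [df Df]; split=> // v; exact/IH/Df.
Qed.

(** Openness of [A] turns equality on [A] into equality near each of its points, so derivatives
    agree on [A] too. This is how a derivative gets replaced by a formula valid only on [A]. *)
Lemma eq_Ck k A f g : open A -> (forall x, A x -> f x = g x) ->
  Ck k A f -> Ck k A g.
Proof.
move=> oA; elim: k f g => [|k IH] f g fg.
  move=> cf x Ax; rewrite /prop_for /continuous_at -fg//.
  apply: cvg_trans (cf x Ax); apply: near_eq_cvg.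
  by near=> y; apply: fg; near: y; exact: open_nbhs_nbhs.
have nfg x : A x -> \forall y \near x, f y = g y.
  by move=> Ax; near=> y; apply: fg; near: y; exact: open_nbhs_nbhs.
move=> [df Df]; split=> [x Ax|v].
  exact: near_eq_differentiable (nfg x Ax) (df x Ax).
by apply: IH (Df v) => x Ax; apply: near_eq_derive; exact: nfg.
Unshelve. all: by end_near. Qed.

Lemma Ck_cst k A (w : W) : Ck k A (cst w).
Proof.
elim: k w => [|k IH] w /=; first by move=> x _; exact: cvg_cst.
split=> [x _|v]; first exact: differentiable_cst.
suff -> : 'D_v (cst w) = cst 0 by exact: IH.
by apply/funext => x; exact: derive_cst.
Qed.

Lemma CkD k A f g : open A -> Ck k A f -> Ck k A g -> Ck k A (f \+ g).
Proof.
move=> oA; elim: k f g => [|k IH] f g.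
  by move=> cf cg x Ax; apply: continuousD; [exact: cf|exact: cg].
move=> [df Df] [dg Dg]; split=> [x Ax|v].
  by apply: differentiableD; [exact: df|exact: dg].
apply: eq_Ck oA _ (IH _ _ (Df v) (Dg v)) => x Ax.
by rewrite [RHS]deriveD//; apply: diff_derivable; [exact: df|exact: dg].
Qed.

Lemma Ck_sum (I : Type) (r : seq I) (P : pred I) (F : I -> V -> W) k A :
  open A -> (forall i, P i -> Ck k A (F i)) ->
  Ck k A (fun x => \sum_(i <- r | P i) F i x).
Proof.
move=> oA FC; elim: r => [|i r IH].
  by under eq_fun do rewrite big_nil; exact: Ck_cst.
under eq_fun do rewrite big_cons.
by case: (boolP (P i)) => // Pi; apply: CkD => //; exact: FC.
Qed.

End general.

Lemma Ck_linear_comp (V W X : normedModType R) k (A : set V) (f : V -> W)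
    (L : {linear W -> X}) :
  continuous L -> open A -> Ck k A f -> Ck k A (L \o f).
Proof.
move=> cL oA; elim: k f => [|k IH] f.
  by move=> cf x Ax; apply: continuous_comp; [exact: cf|exact: cL].
move=> [df Df]; split=> [x Ax|v].
  by apply: differentiable_comp; [exact: df|exact: linear_differentiable].
apply: eq_Ck oA _ (IH _ (Df v)) => x Ax.
have dfx := df x Ax.
rewrite [RHS]deriveE; last first.
  by apply: differentiable_comp => //; exact: linear_differentiable.
rewrite diff_comp//; last exact: linear_differentiable.
by rewrite diff_lin//= deriveE.
Qed.

Lemma Ck_linear (V W : normedModType R) k (A : set V) (L : {linear V -> W}) :
  continuous L -> open A -> Ck k A L.
Proof.
move=> cL oA; case: k => [|k]; first by move=> x _; exact: cL.
split=> [x _|v]; first exact: linear_differentiable.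
apply: (@eq_Ck _ _ _ _ (cst (L v))) => // [x Ax|]; last exact: Ck_cst.
by rewrite deriveE ?diff_lin//; exact: linear_differentiable.
Qed.

Section scalar.
Context {V : normedModType R}.
Implicit Types (A : set V) (f g : V -> R).

Lemma CkM k A f g : open A -> Ck k A f -> Ck k A g -> Ck k A (f \* g).
Proof.
move=> oA; elim: k f g => [|k IH] f g.
  by move=> cf cg x Ax; apply: continuousM; [exact: cf|exact: cg].
move=> Cf Cg; have [df Df] := Cf; have [dg Dg] := Cg.
split=> [x Ax|v]; first by apply: differentiableM; [exact: df|exact: dg].
have := CkD oA (IH _ _ (CkW Cf) (Dg v)) (IH _ _ (CkW Cg) (Df v)).
apply: eq_Ck oA _ => x Ax.
by rewrite [RHS]deriveM//; apply: diff_derivable; [exact: df|exact: dg].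
Qed.

Lemma Ck_prod (I : Type) (r : seq I) (P : pred I) (F : I -> V -> R) k A :
  open A -> (forall i, P i -> Ck k A (F i)) ->
  Ck k A (fun x => \prod_(i <- r | P i) F i x).
Proof.
move=> oA FC; elim: r => [|i r IH].
  by under eq_fun do rewrite big_nil; exact: Ck_cst.
under eq_fun do rewrite big_cons.
by case: (boolP (P i)) => // Pi; apply: CkM => //; exact: FC.
Qed.

(** The derivative of [1/f] is [-(1/f)^2 Df], where [1/f] is C^k by the induction hypothesis. *)
Lemma CkV k A f : open A -> (forall x, A x -> f x != 0) ->
  Ck k A f -> Ck k A (fun x => (f x)^-1).
Proof.
move=> oA f0; elim: k => [|k IH].
  by move=> cf x Ax; apply: continuousV; [exact: f0|exact: cf].
move=> Cf; have [df Df] := Cf; have IHf := IH (CkW Cf).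
split=> [x Ax|v]; first by apply: differentiableV; [exact: df|exact: f0].
have := CkM oA (@Ck_cst V R k A (-1)) (CkM oA (CkM oA IHf IHf) (Df v)).
apply: eq_Ck oA _ => x Ax /=.
rewrite [RHS]deriveV ?f0//; last exact/diff_derivable/df.
by rewrite mulN1r /GRing.scale /= mulNr expr2 invfM.
Qed.

Lemma Ck_det n k A (M : V -> 'M[R]_n) : open A ->
  (forall i j, Ck k A (fun x => M x i j)) -> Ck k A (fun x => \det (M x)).
Proof.
move=> oA MC; rewrite /determinant; apply: Ck_sum => // s _.
apply: CkM => //; first exact: Ck_cst.
exact: Ck_prod.
Qed.

(** Cramer's rule: each entry of the inverse is a cofactor divided by the determinant. *)
Lemma Ck_invmx n k A (M : V -> 'M[R]_n) : open A ->
  (forall x, A x -> M x \in unitmx) ->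
  (forall i j, Ck k A (fun x => M x i j)) ->
  forall i j, Ck k A (fun x => invmx (M x) i j).
Proof.
move=> oA Mu MC i j.
have dV : Ck k A (fun x => (\det (M x))^-1).
  apply: CkV => // [x /Mu|]; first by rewrite unitmxE unitfE.
  exact: Ck_det.
apply: (@eq_Ck _ _ _ _
  ((fun x => (\det (M x))^-1) \* fun x => cofactor (M x) j i)) => //.
  by move=> x /Mu Mx; rewrite /invmx Mx !mxE.
apply: CkM => //; rewrite /cofactor; apply: CkM => //; first exact: Ck_cst.
by apply: Ck_det => // i' j'; under eq_fun do rewrite !mxE.
Qed.

End scalar.
End Ck.

(** * Coordinates and the chain rule *)

Section Ck_rV.
Context {R : realType}.

(** Both directions compose with continuous linear maps: the [j]-th coordinate one way, and the maps
    sending [a] to [a *: delta_mx ord0 j], whose results are summed, the other way. *)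
Lemma Ck_coord (V : normedModType R) (m k : nat) (A : set V)
    (f : V -> 'rV[R]_m) : open A ->
  Ck k A f <-> forall j, Ck k A (fun x => f x ord0 j).
Proof.
move=> oA; split=> [fC j|fC].
  pose coord := fun v : 'rV[R]_m => v ord0 j.
  have coord_lin : linear coord by move=> a u v; rewrite /coord !mxE.
  pose cL := GRing.isLinear.Build _ _ _ _ _ coord_lin.
  pose L : {linear 'rV[R]_m -> R} := HB.pack coord cL.
  by apply: (@Ck_linear_comp _ _ _ _ _ _ _ L) => //; exact: coord_continuous.
have E x : A x -> \sum_j f x ord0 j *: delta_mx ord0 j = f x.
  by move=> _; rewrite -row_sum_delta.
apply: (eq_Ck oA E); apply: Ck_sum => // j _.
pose scale := fun a : R => a *: (delta_mx ord0 j : 'rV[R]_m).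
have scale_lin : linear scale.
  by move=> a u v; rewrite /scale scalerDl scalerA.
pose cL := GRing.isLinear.Build _ _ _ _ _ scale_lin.
pose L : {linear R -> 'rV[R]_m} := HB.pack scale cL.
apply: (@Ck_linear_comp _ _ _ _ _ _ (fun x => f x ord0 j) L) => //.
exact: scalel_continuous.
Qed.

Lemma Ck_mulmx (V : normedModType R) (m p k : nat) (A : set V)
    (f : V -> 'rV[R]_m) (M : V -> 'M[R]_(m, p)) : open A ->
  Ck k A f -> (forall i j, Ck k A (fun x => M x i j)) ->
  Ck k A (fun x => f x *m M x).
Proof.
move=> oA /(Ck_coord _ _ oA) fC MC; apply/Ck_coord => // j.
under eq_fun do rewrite mxE.
by apply: Ck_sum => // i _; apply: CkM.
Qed.

Lemma Ck_mulmxr (V : normedModType R) (m p k : nat) (A : set V)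
    (f : V -> 'rV[R]_m) (M : 'M[R]_(m, p)) : open A ->
  Ck k A f -> Ck k A (fun x => f x *m M).
Proof. by move=> oA fC; apply: Ck_mulmx => // i j; exact: Ck_cst. Qed.

Lemma Ck_id (V : normedModType R) k (A : set V) : open A -> Ck k A id.
Proof.
by move=> oA; apply: (@Ck_linear _ _ _ _ _ idfun) => // x; exact: cvg_id.
Qed.

Lemma mulmxr_continuous (m p : nat) (M : 'M[R]_(m, p)) :
  continuous (mulmxr M : 'rV[R]_m -> 'rV[R]_p).
Proof.
by move=> x; apply: (Ck_mulmxr (k := 0) (A := setT) M openT (Ck_id _ openT)).
Qed.

Lemma diff_rV_sum (n : nat) (W : normedModType R) (g : 'rV[R]_n -> W) a v :
  differentiable g a ->
  'd g a v = \sum_i v ord0 i *: 'D_(delta_mx ord0 i) g a.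
Proof.
move=> dg; rewrite {1}(row_sum_delta v) linear_sum; apply: eq_bigr => i _.
by rewrite linearZ deriveE.
Qed.

(** Passing to coordinates makes [g] scalar-valued. The chain rule then writes ['D_v (g \o f)] as a
    sum of products of coordinates of ['D_v f] with partial derivatives of [g] composed with [f];
    the induction hypothesis covers the latter. *)
Lemma Ck_comp (V : normedModType R) (n m k : nat) (A : set V)
    (B : set 'rV[R]_n) (f : V -> 'rV[R]_n) (g : 'rV[R]_n -> 'rV[R]_m) :
  open A -> open B -> f @` A `<=` B -> Ck k A f -> Ck k B g ->
  Ck k A (g \o f).
Proof.
move=> oA oB fAB fC /(Ck_coord _ _ oB) gC; apply/Ck_coord => // j.
move: (gC j); rewrite -/((fun y => g y ord0 j) \o f).
move: (fun y => g y ord0 j) => {gC j}{}g gC.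
have fB x : A x -> B (f x) by move=> Ax; apply: fAB; exists x.
elim: k f g gC fC fAB fB => [|k IH] f g gC fC fAB fB.
  by move=> x Ax; apply: continuous_comp; [exact: fC|exact/gC/fB].
have [df Df] := fC; have [dg Dg] := gC.
split=> [x Ax|v].
  by apply: differentiable_comp; [exact: df|exact/dg/fB].
apply: (@eq_Ck _ _ _ _ _
  (fun x => \sum_i 'D_v f x ord0 i * 'D_(delta_mx ord0 i) g (f x))) => //.
  move=> x Ax; have dfx := df x Ax; have dgx := dg _ (fB x Ax).
  rewrite [RHS]deriveE; last exact: differentiable_comp.
  by rewrite diff_comp//= diff_rV_sum// deriveE.
apply: Ck_sum => // i _; apply: CkM => //.
  exact: (proj1 (Ck_coord _ _ oA) (Df v) i).
exact: (IH f ('D_(delta_mx ord0 i) g) (Dg _) (CkW fC)).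
Qed.

End Ck_rV.

(** * The inverse function theorem *)

(* The library declares matrices both complete and normed, but not their join,
   which [banach_fixed_point] requires. *)
HB.instance Definition _ (R : realType) m n := Complete.on 'M[R]_(m, n).

(** * The mean value inequality *)

Section rV_norm.
Context {R : realType}.

Lemma rV_coord_norm (n : nat) (u : 'rV[R]_n) j : `|u ord0 j| <= `|u|.
Proof.
rewrite [leRHS]/Num.Def.normr /= mx_normrE.
exact: (le_bigmax _ (fun ij => `|u ij.1 ij.2|) (ord0, j)).
Qed.

Lemma rV_norm_le (n : nat) (u : 'rV[R]_n) c : 0 <= c ->
  (forall j, `|u ord0 j| <= c) -> `|u| <= c.
Proof.
move=> c0 uc; rewrite /Num.Def.normr /= mx_normrE.
rewrite (bigmax_le _ c0)//= => -[i j] _.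
by rewrite ord1; exact: uc.
Qed.

Lemma ball_segment (V : normedModType R) (a x y : V) (e t : R) :
  ball a e x -> ball a e y -> 0 <= t <= 1 -> ball a e (y + t *: (x - y)).
Proof.
rewrite -ball_normE /ball_ /= => ax ay /andP[t0 t1].
have -> : a - (y + t *: (x - y)) = t *: (a - x) + (1 - t) *: (a - y).
  rewrite !scalerBr !scalerBl !scale1r [in RHS]addrACA -!opprD.
  by rewrite [t *: a + _]addrC subrK; congr (_ - _); rewrite addrCA.
apply: le_lt_trans (_ : Num.max `|a - x| `|a - y| < e).
  rewrite (le_trans (ler_normD _ _))// !normrZ !ger0_norm ?subr_ge0//.
  set M := Num.max _ _; have -> : M = t * M + (1 - t) * M.
    by rewrite -mulrDl subrKC mul1r.
  by rewrite lerD// ler_wpM2l ?subr_ge0// le_max lexx ?orbT.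
by rewrite gt_max ax ay.
Qed.

Lemma diff_line (V : normedModType R) (y u : V) (t : R) :
  differentiable (fun s : R => y + s *: u) t /\
  'd (fun s : R => y + s *: u) t 1 = u.
Proof.
pose scale := fun a : R => a *: u.
have scale_lin : linear scale.
  by move=> a v w; rewrite /scale scalerDl scalerA.
pose cL := GRing.isLinear.Build _ _ _ _ _ scale_lin.
pose L : {linear R -> V} := HB.pack scale cL.
have [||dl dE] := @eps_differentiable R R V (fun s => y + s *: u) t L _ _.
- exact: scalel_continuous.
- move=> e e0; near=> h; rewrite /= /scale.
  rewrite scalerDl [h *: u + _]addrC addrA [_ + h *: u - _]addrAC subrr add0r.
  rewrite subrr normr0.
  by rewrite mulr_ge0// ltW.
- by split=> //; rewrite dE /= /scale scale1r.
Unshelve. all: by end_near. Qed.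

(** The mean value theorem applies to each coordinate of [r] along the segment from [y] to [x]. The
    norm being the maximum of the coordinates in absolute value, the constant [c] is not
    degraded. *)
Lemma ball_lipschitz (n m : nat) (r : 'rV[R]_n -> 'rV[R]_m) a (e c : R) :
  0 <= c -> (forall x, ball a e x -> differentiable r x) ->
  (forall x v, ball a e x -> `|'d r x v| <= c * `|v|) ->
  forall x y, ball a e x -> ball a e y -> `|r x - r y| <= c * `|x - y|.
Proof.
move=> c0 dr rc x y ax ay; apply: rV_norm_le => [|j]; first by rewrite mulr_ge0.
pose l (t : R) := y + t *: (x - y).
have dl t : differentiable l t by exact: (proj1 (diff_line _ _ _)).
have drl (t : R) : 0 <= t <= 1 -> differentiable (r \o l) t.
  move=> t01; apply: differentiable_comp => //.
  by apply: dr; exact: ball_segment.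
have der (t : R) : 0 <= t <= 1 ->
    is_derive t 1 (fun t => r (l t) ord0 j) ('d r (l t) (x - y) ord0 j).
  move=> t01; have drlt := drl t t01.
  have derv : derivable (r \o l) t 1 by exact: diff_derivable.
  apply: DeriveDef; first exact: (proj1 (derivable_mxP _ _ _) derv ord0 j).
  have := derive_mx derv; rewrite deriveE// diff_comp//; last first.
    by apply: dr; exact: ball_segment.
  by rewrite /= (proj2 (diff_line _ _ _)) => ->; rewrite mxE.
have [||t] := @MVT R (fun t => r (l t) ord0 j)
    (fun t => 'd r (l t) (x - y) ord0 j) 0 1 ltr01 _ _.
- by move=> t; rewrite in_itv /= => /andP[t0 t1]; apply: der; rewrite !ltW.
- apply: continuous_in_subspaceT => t; rewrite inE /= in_itv /= => t01.
  have /derivable1_diffP := @ex_derive _ _ _ _ _ _ _ (der t t01).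
  exact: differentiable_continuous.
- rewrite in_itv /= => /andP[t0 t1]; rewrite subr0 mulr1.
  rewrite /l scale1r scale0r addr0 subrKC !mxE => ->.
  apply: le_trans (rV_coord_norm _ _) _; apply: rc.
  by apply: ball_segment; rewrite ?ltW.
Qed.

End rV_norm.

Lemma diff_sub_id (R : realType) (V : normedModType R) (f : V -> V) x v :
  differentiable f x ->
  differentiable (fun y => f y - y) x /\
  'd (fun y => f y - y) x v = 'd f x v - v.
Proof.
rewrite -[fun y => _]/(f - id) => df.
have did : is_diff x id id := is_diff_id x.
split; first exact: differentiableB.
by rewrite diffB// [in LHS]/= [X in _ - X v]diff_val.
Qed.

(** * Maps tangent to the identity *)

Section LocalInverse.
Context {R : realType} {n : nat}.
Implicit Types (phi G : 'rV[R]_n -> 'rV[R]_n) (U : set 'rV[R]_n).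

(** The differential of [phi - id] vanishes at [a] and, by continuity of the partial derivatives,
    stays small nearby; the mean value inequality concludes. *)
Lemma near_id_lipschitz phi U a : open U -> U a -> Ck 1 U phi ->
  (forall v, 'd phi a v = v) ->
  exists e : R, [/\ 0 < e, ball a e `<=` U & forall x y, ball a e x ->
    ball a e y -> `|(phi x - x) - (phi y - y)| <= 2^-1 * `|x - y|].
Proof.
move=> oU Ua [dphi Dphi] dphia.
(* Each of the [n] partial derivatives may vary by [d], for a total of at most 1/2; [n.+1] keeps [d]
   positive when [n = 0]. *)
pose d : R := (2 * n.+1%:R)^-1.
have d0 : 0 < d by rewrite invr_gt0 mulr_gt0// ltr0n.
have nD i : \forall x \near a,
    `|'D_(delta_mx ord0 i) phi a - 'D_(delta_mx ord0 i) phi x| <= d.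
  by have /cvgrPdist_le := Dphi (delta_mx ord0 i) a Ua; exact.
have : \forall x \near a, U x /\ forall i,
    `|'D_(delta_mx ord0 i) phi a - 'D_(delta_mx ord0 i) phi x| <= d.
  near=> x; split; first by near: x; exact: open_nbhs_nbhs.
  by move=> i; move: i; near: x; apply: filter_forall.
move=> /nbhs_ballP[e /= e0 He]; exists e; split=> // [x /He[]//|x y ax ay].
have dphiB x' v : ball a e x' ->
    differentiable (fun y => phi y - y) x' /\
    'd (fun y => phi y - y) x' v = 'd phi x' v - v.
  by move=> /He[Ux' _]; exact/diff_sub_id/dphi.
apply: (@ball_lipschitz _ _ _ (fun y => phi y - y) a e _ _ _ _ x y ax ay).
- by rewrite invr_ge0.
- by move=> x' /(dphiB _ 0)[].
move=> x' v ax'; rewrite (proj2 (dphiB _ v ax')).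
have [Ux' Dx'] := He _ ax'.
(* As ['d phi a] is the identity, [v] is ['d phi a v], expanded in the partial derivatives at
   [a]. *)
have -> : 'd phi x' v - v = \sum_i v ord0 i *:
    ('D_(delta_mx ord0 i) phi x' - 'D_(delta_mx ord0 i) phi a).
  have E1 := diff_rV_sum v (dphi _ Ux').
  have E2 := diff_rV_sum v (dphi _ Ua).
  under [RHS]eq_bigr do rewrite scalerBr.
  by rewrite sumrB -E1 -E2; congr (_ - _); exact/esym/dphia.
apply: le_trans (ler_norm_sum _ _ _) _.
apply: (@le_trans _ _ (\sum_(i < n) `|v| * d)).
  apply: ler_sum => i _; rewrite normrZ.
  by rewrite ler_pM// ?rV_coord_norm// distrC.
rewrite sumr_const card_ord -mulrnAr [leLHS]mulrC ler_wpM2r// -mulr_natr /d.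
rewrite invfM -mulrA -[leRHS]mulr1 ler_wpM2l// mulrC ler_pdivrMr ?ltr0n//.
by rewrite mul1r ler_nat.
Unshelve. all: by end_near. Qed.

Lemma near_id_open phi a (e : R) :
  (forall x y, ball a e x -> ball a e y ->
    `|(phi x - x) - (phi y - y)| <= 2^-1 * `|x - y|) ->
  open (phi @` ball a e).
Proof.
move=> lip; rewrite openE => _ [x0 ax0 <-].
(* Half of the room left around [x0], so that the closed ball [B] of radius [rho] lies in the open
   ball. *)
pose rho := (e - `|a - x0|) / 2.
have rho0 : 0 < rho.
  by move: ax0; rewrite -ball_normE /= => ax0; rewrite divr_gt0// subr_gt0.
pose B := closed_ball_ Num.norm x0 rho.
have Ba x : B x -> ball a e x.
  rewrite /B /closed_ball_ -ball_normE /ball_/= => x0x.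
  rewrite (le_lt_trans (ler_distD x0 _ _))// -ltrBrDl (le_lt_trans x0x)//.
  rewrite /rho ltr_pdivrMr// ltr_pMr ?ltr1n// subr_gt0.
  by move: ax0; rewrite -ball_normE.
have Bx0 : B x0 by rewrite /B /closed_ball_/= subrr normr0 ltW.
(* The other half of [rho] is the displacement allowed by the Lipschitz bound, so the map [T] below
   preserves [B]. *)
apply/nbhs_ballP; exists (rho / 2); first by rewrite /= divr_gt0.
move=> y; rewrite -ball_normE /ball_/= => x0y.
(* A fixed point of the half-contraction [T] is a solution of [phi x = y]. *)
pose T x := y - (phi x - x).
have TB : {homo T : x / B x >-> B x}.
  move=> x Bx; rewrite /B /closed_ball_/= /T.
  have -> : x0 - (y - (phi x - x)) =
      (phi x0 - y) - ((phi x0 - x0) - (phi x - x)).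
    rewrite opprB [phi x0 - x0]addrC opprD opprB; apply/matrixP => i j.
    by rewrite !mxE; ring.
  rewrite (le_trans (ler_normB _ _))// [leRHS]splitr lerD//; first exact: ltW.
  apply: le_trans (lip _ _ ax0 (Ba _ Bx)) _.
  by rewrite mulrC ler_pM2r ?invr_gt0.
have [|||x Bx xT] := @banach_fixed_point R _ B (mkfun_fun TB).
- exists (2^-1)%:nng; split=> /=; first by rewrite invf_lt1// ltr1n.
  move=> [x x'] [/= Bx Bx'] /=.
  rewrite /mkfun /T.
  have -> : y - (phi x - x) - (y - (phi x' - x')) = 
     (phi x' - x') - (phi x - x).
    by apply/matrixP => i j; rewrite !mxE; ring.
  by rewrite distrC lip//; exact: Ba.
- exact: closed_closed_ball_.
- by exists x0.
exists x; first by have := Ba _ Bx; rewrite -ball_normE.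
have xE : x = y - (phi x - x) by [].
apply/matrixP => i j; have := congr1 (fun M : 'rV[R]_n => M i j) xE.
by rewrite !mxE => xE'; lra.
Qed.
End LocalInverse.

(** * Smoothness of the inverse *)

Section InverseFunction.
Context {R : realType} {n : nat}.
Implicit Types (phi G : 'rV[R]_n -> 'rV[R]_n) (U : set 'rV[R]_n).

Lemma jacobian_entry m (g : 'rV[R]_n -> 'rV[R]_m) x i j :
  differentiable g x -> 'J g x i j = 'D_(delta_mx ord0 i) g x ord0 j.
Proof. by move=> dg; rewrite deriveE// mxE. Qed.

Lemma Ck_jacobian m k U (g : 'rV[R]_n -> 'rV[R]_m) : open U ->
  Ck k.+1 U g -> forall i j, Ck k U (fun x => 'J g x i j).
Proof.
move=> oU [dg Dg] i j.
have E x : U x -> 'D_(delta_mx ord0 i) g x ord0 j = 'J g x i j.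
  by move=> Ux; rewrite jacobian_entry//; exact: dg.
apply: (eq_Ck oU E).
exact: (proj1 (Ck_coord _ _ oU) (Dg (delta_mx ord0 i)) j).
Qed.

Section Smoothness.
Variables (phi G : 'rV[R]_n -> 'rV[R]_n) (U : set 'rV[R]_n).
Hypotheses (oU : open U) (ophiU : open (phi @` U)) (phiC : Cinfty U phi).
Hypothesis phiK : forall x, U x -> G (phi x) = x.
Hypothesis lip : forall x y, U x -> U y -> `|x - y| <= 2 * `|phi x - phi y|.
Hypothesis Ju : forall x, U x -> 'J phi x \in unitmx.

Let dphi x : U x -> differentiable phi x.
Proof. by have [dphi _] := phiC 1; exact: dphi. Qed.

(** By [lip], the increment of [G] is at most twice the increment [h] of [phi], so an error that is
    small relative to the former is also small relative to [h]. *)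
Lemma inverse_differentiable y : (phi @` U) y ->
  differentiable G y /\ forall v, 'd G y v = v *m invmx ('J phi (G y)).
Proof.
move=> [x0 Ux0 <-]; rewrite phiK//.
set J := 'J phi x0; have JE v : 'd phi x0 v = v *m J by rewrite mul_rV_lin1.
have cJ := @mulmxr_continuous R n n (invmx J).
have [K K0 JK] := linear_lipschitz cJ.
have H (e : R) : 0 < e -> \forall h \near 0,
    `|G (h + phi x0) - G (phi x0) - mulmxr (invmx J) h| <= e * `|h|.
  (* [K] bounds the inverse Jacobian and 2 is the Lipschitz constant of [G]; both factors cancel in
     the final estimate. *)
  move=> e0; have e'0 : 0 < e / (K * 2) by rewrite divr_gt0// mulr_gt0.
  have := differentiable_eps (dphi Ux0) e'0 => /nbhs_ballP[d /= d0 Hd].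
  have nU : \forall h \near (0 : 'rV[R]_n), (phi @` U) (h + phi x0).
    have := open_nbhs_nbhs (conj ophiU (ex_intro2 _ _ x0 Ux0 erefl) :
      open_nbhs (phi x0) (phi @` U)).
    by rewrite nbhs_nearE (near_shift 0) subr0.
  have nd : \forall h \near (0 : 'rV[R]_n), `|h| < d / 2.
    apply/nbhs_normP; exists (d / 2); first by rewrite /= divr_gt0.
    by move=> h /=; rewrite sub0r normrN.
  near=> h; have : (phi @` U) (h + phi x0) by near: h.
  have hd : `|h| < d / 2 by near: h.
  move=> [x Ux xE]; rewrite -xE !phiK//.
  have hE : h = phi x - phi x0 by rewrite xE addrK.
  have xh : `|x - x0| <= 2 * `|h| by rewrite hE; exact: lip.
  have {Hd} := Hd (x - x0) _; rewrite subrK -hE JE => Hd.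
  (* The error of [G] is, up to sign, the error of [phi] transported by the inverse Jacobian. *)
  rewrite (_ : x - x0 - _ = - mulmxr (invmx J) (h - (x - x0) *m J)); last first.
    by rewrite /= mulmxBl mulmxK ?opprB//; exact: Ju.
  rewrite normrN; apply: le_trans (JK _) _.
  have {}Hd : `|h - (x - x0) *m J| <= e / (K * 2) * `|x - x0|.
    apply: Hd; rewrite -ball_normE /ball_/= sub0r normrN.
    by rewrite (le_lt_trans xh)// mulrC -ltr_pdivlMr.
  apply: le_trans (ler_wpM2l (ltW K0) Hd) _.
  apply: (@le_trans _ _ (K * (e / (K * 2) * (2 * `|h|)))).
    by rewrite !ler_wpM2l// ltW.
  by rewrite le_eqVlt; apply/orP; left; apply/eqP; field; rewrite gt_eqF.
have [dG dGE] := eps_differentiable cJ H.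
split; first exact: dG.
by move=> v; exact: (congr1 (fun h : 'rV[R]_n -> 'rV[R]_n => h v) dGE).
Unshelve. all: by end_near. Qed.

(** Bootstrapping: the differential of [G] is the inverse of ['J phi] taken along [G], so it is C^k
    as soon as [G] is, and [G] is then C^(k+1). *)
Lemma inverse_Cinfty : Cinfty (phi @` U) G.
Proof.
have GU : G @` (phi @` U) `<=` U by move=> _ [_ [x Ux <-] <-]; rewrite phiK.
elim=> [|k IH].
  by move=> y /inverse_differentiable[dG _]; exact: differentiable_continuous.
split=> [y /inverse_differentiable[]//|v].
have E y : (phi @` U) y -> v *m invmx ('J phi (G y)) = 'D_v G y.
  move=> /inverse_differentiable[dG dGE].
  by rewrite -dGE deriveE.
apply: (eq_Ck ophiU E); apply: Ck_mulmx => //; first exact: Ck_cst.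
apply: Ck_invmx => // [y phiUy|i j].
  by apply/Ju/GU; exists y.
have JE y : (phi @` U) y ->
    ('D_(delta_mx ord0 i) phi \o G) y ord0 j = 'J phi (G y) i j.
  by move=> phiUy; rewrite jacobian_entry//; apply/dphi/GU; exists y.
apply: (eq_Ck ophiU JE).
have /(_ (delta_mx ord0 i)) DC := (phiC k.+1).2.
exact: (proj1 (Ck_coord _ _ ophiU) (Ck_comp ophiU oU GU IH DC) j).
Qed.

End Smoothness.

Definition local_diffeo phi U0 G :=
  [/\ open U0, open (phi @` U0), forall x, U0 x -> G (phi x) = x,
      Cinfty U0 phi & Cinfty (phi @` U0) G].

Lemma near_id_local_diffeo phi U a : open U -> U a -> Cinfty U phi ->
  (forall v, 'd phi a v = v) ->
  exists U0 G, [/\ U0 a, U0 `<=` U & local_diffeo phi U0 G].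
Proof.
move=> oU Ua phiC dphia.
have detC := Ck_det oU (Ck_jacobian oU (phiC 1)).
have Ja : 'J phi a = 1%:M.
  apply/row_matrixP => i; rewrite !rowE mulmx1.
  by rewrite [LHS]mul_rV_lin1; exact: dphia.
(* Continuity of the determinant makes [Z] a neighborhood of [a]; working in its interior keeps the
   Jacobian invertible. *)
pose Z := U `&` [set x | 'J phi x \in unitmx].
have /nbhs_interior nZ : nbhs a Z.
  apply: filterI; first exact: open_nbhs_nbhs.
  have : \forall x \near a, \det ('J phi x) != 0.
    apply: (@cvgr_neq0 _ _ _ _ _ _ (\det ('J phi a)) (detC a Ua)).
    by rewrite Ja det1 oner_neq0.
  by apply: filterS => x /=; rewrite unitmxE unitfE.
have U'a : Z° a by exact: nbhs_singleton.
have U'U : Z° `<=` U by move=> x /interior_subset[].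
have oU' : open Z° := open_interior Z.
have [e [e0 aeU lip]] := near_id_lipschitz oU' U'a (Ck_sub U'U (phiC 1)) dphia.
(* Absorbing half of the left-hand side shows that [phi] is injective with a 2-Lipschitz inverse. *)
have lip2 x y : ball a e x -> ball a e y -> `|x - y| <= 2 * `|phi x - phi y|.
  move=> ax ay; have := lip _ _ ax ay.
  have : `|x - y| <= `|(phi x - x) - (phi y - y)| + `|phi x - phi y|.
    rewrite (_ : x - y = (phi x - phi y) - ((phi x - x) - (phi y - y))).
      by rewrite [leRHS]addrC ler_normB.
    by apply/matrixP => i j; rewrite !mxE; ring.
  lra.
(* Off the image of the ball, [G] takes the default value [a]. *)
pose G y := xget a [set x | ball a e x /\ phi x = y].
have GK x : ball a e x -> G (phi x) = x.
  move=> ax; apply: xget_unique => // y [ay yx].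
  apply/eqP; rewrite -subr_eq0 -normr_le0.
  by have := lip2 _ _ ay ax; rewrite yx subrr normr0 mulr0.
have oB : open (ball a e) := ball_open a e.
have ophi := near_id_open lip.
have phiCb : Cinfty (ball a e) phi.
  by move=> k; apply: Ck_sub (phiC k) => x /aeU/U'U.
exists (ball a e), G; split; first exact: ballxx.
  by move=> x /aeU/U'U.
split=> //; apply: inverse_Cinfty => // x /aeU/interior_subset[_].
by [].
Qed.

Theorem inverse_function phi U a : open U -> U a -> Cinfty U phi ->
  'J phi a \in unitmx ->
  exists U0 G, [/\ U0 a, U0 `<=` U & local_diffeo phi U0 G].
Proof.
move=> oU Ua phiC; set J := 'J phi a => Ju.
have dphi : differentiable phi a by case: (phiC 1) => + _; exact.
(* Normalizing by the inverse Jacobian reduces to a map tangent to the identity at [a]. *)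
pose psi := mulmxr (invmx J) \o phi.
have psiC : Cinfty U psi by move=> k; exact: Ck_mulmxr.
have dpsi v : 'd psi a v = v.
  have cJ := @mulmxr_continuous R n n (invmx J).
  have dJ : differentiable (mulmxr (invmx J) : 'rV_n -> 'rV_n) (phi a).
    exact: linear_differentiable.
  have E1 := congr1 (fun h : 'rV[R]_n -> 'rV[R]_n => h v) (diff_comp dphi dJ).
  have E2 := congr1 (fun h : 'rV[R]_n -> 'rV[R]_n => h ('d phi a v))
    (diff_lin (phi a) cJ).
  rewrite [LHS]E1 [LHS]E2 /=.
  have -> : 'd phi a v = v *m J by rewrite mul_rV_lin1.
  by rewrite mulmxK.
have [U0 [G [U0a U0U [oU0 opsi GK _ GC]]]] :=
  near_id_local_diffeo oU Ua psiC dpsi.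
have phiE : phi @` U0 = mulmxr (invmx J) @^-1` (psi @` U0).
  apply/seteqP; split=> [_ [x Ux <-]|y [x Ux xy]]; first by exists x.
  exists x => //; have := congr1 (mulmxr J) xy.
  by rewrite /= !mulmxKV.
have ophi : open (phi @` U0).
  rewrite phiE; apply: open_comp => // y _; exact: mulmxr_continuous.
exists U0, (G \o mulmxr (invmx J)); split=> //; split=> //.
  by move=> k; apply: Ck_sub (phiC k).
move=> k; apply: (Ck_comp ophi opsi _ _ (GC k)).
  by move=> _ [_ [x Ux <-] <-]; exists x.
exact/Ck_mulmxr/Ck_id.
Qed.

End InverseFunction.

(** * Preimages of submanifolds *)

Section Charts.
Context {R : realType} {X : topologicalType} {n : nat}.
Implicit Type c : chart R X n.

Lemma chart_continuous c x : cdom c x -> {for x, continuous c}.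
Proof.
have [cc _ _ _] := coord_homeo c; move=> cx.
have := cc; rewrite continuous_open_subspace; last exact: cdom_open.
by apply; rewrite inE.
Qed.

Lemma chart_open_image c O : open O -> open (c @` (cdom c `&` O)).
Proof.
move=> oO; have [_ _ _ /(_ O oO)] := coord_homeo c; move=> [W1 oW1 ->].
by apply: openI => //; exact: cimage_open.
Qed.

Lemma chart_inj c x y : cdom c x -> cdom c y -> c x = c y -> x = y.
Proof.
by move=> cx cy; have [_ ci _ _] := coord_homeo c; apply: ci; rewrite inE.
Qed.

Lemma chart_open_preimage c W : open W -> open (cdom c `&` c @^-1` W).
Proof.
move=> oW; rewrite openE => x [cx Wx]; apply: filterI.
  exact: open_nbhs_nbhs (conj (cdom_open c) cx).
exact: (chart_continuous cx (open_nbhs_nbhs (conj oW Wx))).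
Qed.

Section compose.
Variables (c : chart R X n) (phi G : 'rV[R]_n -> 'rV[R]_n) (U0 : set 'rV[R]_n).
Hypotheses (dphi : local_diffeo phi U0 G) (U0c : U0 `<=` c @` cdom c).

Let A := cdom c `&` c @^-1` U0.

Let image_eq : (phi \o c) @` A = phi @` U0.
Proof.
apply/seteqP; split=> [_ [x [cx Ux] <-]|_ [u Uu <-]]; first by exists (c x).
by have [x cx xu] := U0c Uu; exists x; rewrite /= ?xu//; split; rewrite /= ?xu.
Qed.

Lemma compose_chart_subproof :
  [/\ open A, open ((phi \o c) @` A) &
      homeomorphism_on A (phi \o c) ((phi \o c) @` A)].
Proof.
have [oU0 oV GK phiC GC] := dphi.
have oA : open A by exact: chart_open_preimage.
split=> //; first by rewrite image_eq.
split=> //.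
- rewrite continuous_open_subspace// => x /[!inE] -[cx Ux].
  apply: continuous_comp; first exact: chart_continuous.
  exact: Ck_continuous (phiC 0) Ux.
- move=> x y /[!inE] -[cx Ux] [cy Uy] /= xy; apply: (chart_inj cx cy).
  by rewrite -(GK _ Ux) xy GK.
- move=> O oO; have [_ _ _ /(_ O oO)] := coord_homeo c.
  move=> [W1 oW1 OE].
  exists (phi @` (U0 `&` W1)).
    have -> : phi @` (U0 `&` W1) = phi @` U0 `&` G @^-1` W1.
      apply/seteqP; split=> [_ [u [Uu W1u] <-]|y [[u Uu <-]]] /=.
        by rewrite GK//; split=> //; exists u.
      by rewrite GK// => W1u; exists u.
    rewrite openE => y [Vy W1y]; apply: filterI.
      exact: open_nbhs_nbhs (conj oV Vy).
    exact: (Ck_continuous (GC 0) Vy (open_nbhs_nbhs (conj oW1 W1y))).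
  rewrite image_eq; apply/seteqP; split.
    move=> _ [x [[cx Ux] Ox] <-]; split; first by exists (c x).
    exists (c x) => //; split=> //.
    by have : (c @` (cdom c `&` O)) (c x) by [exists x]; rewrite OE => -[].
  move=> _ [_ [u [Uu W1u] <-]].
  have : (c @` cdom c `&` W1) u by split=> //; exact: U0c.
  rewrite -OE => -[x [cx Ox] xu]; exists x; rewrite /= ?xu//.
  by split; rewrite // /A /= ?xu.
Qed.

Definition compose_chart : chart R X n :=
  let P := compose_chart_subproof in
  Chart (let: And3 oA _ _ := P in oA) (let: And3 _ oI _ := P in oI)
        (let: And3 _ _ hA := P in hA).

Lemma cdom_compose_chart : cdom compose_chart = cdom c `&` c @^-1` U0.
Proof. by []. Qed.

Lemma compose_chartE : compose_chart = phi \o c :> (X -> 'rV[R]_n).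
Proof. by []. Qed.

End compose.
End Charts.

Section Atlas.
Context {R : realType} {n : nat} (M : manifold R n).

Lemma smooth_in_charts_domain_open m (Y : topologicalType) (F : M -> Y)
    (c1 : chart R M n) (c2 : chart R Y m) : continuous F ->
  open (c1 @` (cdom c1 `&` F @^-1` cdom c2)).
Proof.
move=> cF; apply: chart_open_image.
by apply: open_comp => //; exact: cdom_open.
Qed.

(** By maximality of the atlas, compatibility with each of its charts suffices; the new transition
    maps are those of [c] composed with [G] or with [phi]. *)
Lemma atlas_compose_chart (c : chart R M n) (phi G : 'rV[R]_n -> 'rV[R]_n)
    (U0 : set 'rV[R]_n) (dphi : local_diffeo phi U0 G)
    (U0c : U0 `<=` c @` cdom c) :
  atlas c -> atlas (compose_chart dphi U0c).
Proof.
move=> Ac; apply: atlas_maximal => c2 Ac2.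
have cid : continuous (@id M) by move=> x; exact: cvg_id.
have [oU0 oV GK phiC GC] := dphi.
have [[g gC gE] [g2 g2C g2E]] := atlas_compatible Ac Ac2.
split.
- exists (g \o G); last first.
    by move=> x; rewrite cdom_compose_chart compose_chartE /= => -[cx Ux] c2x;
      rewrite GK// gE.
  have oA :=
    @smooth_in_charts_domain_open _ _ _ (compose_chart dphi U0c) c2 cid.
  have oB := @smooth_in_charts_domain_open _ _ _ c c2 cid.
  move=> k; apply: (Ck_comp oA oB _ _ (gC k)).
    move=> _ [_ [x [[cx Ux] c2x] <-] <-].
    by rewrite compose_chartE /= GK//; exists x.
  apply: Ck_sub (GC k) => _ [x [[cx Ux] c2x] <-].
  by rewrite compose_chartE; exists (c x).
- exists (phi \o g2); last first.
    by move=> x c2x [cx Ux]; rewrite compose_chartE /= g2E.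
  have oA :=
    @smooth_in_charts_domain_open _ _ _ c2 (compose_chart dphi U0c) cid.
  move=> k; apply: (Ck_comp oA oU0 _ _ (phiC k)).
    by move=> _ [_ [x [c2x [cx Ux]] <-] <-]; rewrite g2E.
  apply: Ck_sub (g2C k) => _ [x [c2x [cx Ux]] <-].
  by exists x.
Qed.

End Atlas.

(** * Slice charts from submersions *)

(** Let the rows of [K] be a basis of the left kernel of [A], and take [C *m A = 1] and
    [K *m B = 1]. Then [col_mx K C *m row_mx B A] is block lower triangular with identity diagonal
    blocks, hence invertible. *)
Lemma row_full_complete (R : realType) (d m : nat) (A : 'M[R]_(d + m, m)) :
  row_full A -> exists B : 'M[R]_(d + m, d), row_mx B A \in unitmx.
Proof.
move=> Afull; have /row_fullP[C CA] := Afull.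
have rK : \rank (kermx A) = d.
  by rewrite mxrank_ker (eqP Afull) addnK.
have [K [Kfree KA]] : exists K : 'M[R]_(d, d + m), row_free K /\ K *m A = 0.
  have := row_base_free (kermx A); have : row_base (kermx A) *m A = 0.
    by apply/sub_kermxP; rewrite eq_row_base.
  move: (row_base (kermx A)); rewrite rK => K KA Kf; by exists K.
have /row_freeP[B KB] := Kfree; exists B.
have : col_mx K C *m row_mx B A \in unitmx.
  rewrite mul_col_row KA CA KB unitmxE det_lblock !det1 mulr1.
  exact: unitr1.
by rewrite unitmx_mul => /andP[].
Qed.

Lemma submersion_chart (R : realType) (d m : nat) (M : manifold R (d + m))
    (c : chart R M (d + m)) x (W : set 'rV[R]_(d + m))
    (h : 'rV[R]_(d + m) -> 'rV[R]_m) :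
  atlas c -> cdom c x -> open W -> W `<=` c @` cdom c -> W (c x) ->
  Cinfty W h -> row_full ('J h (c x)) ->
  exists c', [/\ atlas c', cdom c' x, cdom c' `<=` cdom c `&` c @^-1` W &
    forall y, cdom c' y -> rsubmx (c' y) = h (c y)].
Proof.
move=> Ac cx oW Wc Wx hC /row_full_complete[B BJ].
(* Putting [h] last makes [phi \o c] a slice chart for the zero set of
   [h \o c]. *)
pose phi y := row_mx (y *m B) (h y).
have phiC : Cinfty W phi.
  move=> k; apply/Ck_coord => // j; rewrite /phi.
  case: (split_ordP j) => j' ->.
    under eq_fun do rewrite row_mxEl.
    by move: j'; apply/(Ck_coord _ _ oW)/Ck_mulmxr/Ck_id.
  under eq_fun do rewrite row_mxEr.
  by move: j'; apply/(Ck_coord _ _ oW)/hC.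
have dphi : differentiable phi (c x) by case: (phiC 1) => + _; exact.
have dh : differentiable h (c x) by case: (hC 1) => + _; exact.
(* [B] was chosen to make this matrix invertible. *)
have phiJ : 'J phi (c x) = row_mx B ('J h (c x)).
  apply/matrixP => i j; rewrite jacobian_entry//.
  have dB : differentiable (mulmxr B : 'rV[R]_(d + m) -> 'rV[R]_d) (c x).
    exact/linear_differentiable/mulmxr_continuous.
  rewrite (derive_mx (diff_derivable dphi)) mxE.
  case: (split_ordP j) => j' ->.
    have -> : (fun t => phi t ord0 (lshift m j')) = fun t => mulmxr B t ord0 j'.
      by apply/funext => t; rewrite /phi row_mxEl.
    have := derive_mx (diff_derivable (v := delta_mx ord0 i) dB).
    move=> /(congr1 (fun M : 'rV[R]_d => M ord0 j')); rewrite mxE => <-.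
    rewrite row_mxEl (deriveE _ dB).
    have -> := congr1
      (fun f : 'rV[R]_(d + m) -> 'rV[R]_d => f (delta_mx ord0 i))
      (diff_lin (c x) (@mulmxr_continuous R _ _ B)).
    by rewrite /= -rowE mxE.
  have -> : (fun t => phi t ord0 (rshift d j')) = fun t => h t ord0 j'.
    by apply/funext => t; rewrite /phi row_mxEr.
  rewrite row_mxEr jacobian_entry// (derive_mx (diff_derivable dh)).
  by rewrite mxE.
have [|U0 [G [U0x U0W dU0]]] := inverse_function oW Wx phiC.
  by rewrite phiJ.
have U0c : U0 `<=` c @` cdom c by move=> u /U0W/Wc.
exists (compose_chart dU0 U0c); split.
- exact: atlas_compose_chart.
- by [].
- by move=> y [cy Uy]; split=> //; exact: U0W.
- by move=> y _; rewrite compose_chartE /phi /= row_mxKr.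
Qed.

(** * Transversality in slice charts *)

Section TransversePreimage.
Context {R : realType} {n1 k m : nat}.
Context (M : manifold R n1) (N : manifold R (k + m)) (F : M -> N) (V : set N).

(** Along a curve in [V] the last [m] coordinates vanish identically near 0, hence so do their
    derivatives. *)
Lemma tangent_slice (c : chart R N (k + m)) y v :
  (forall z, cdom c z ->
    (V z <-> forall i : 'I_(k + m), (k <= i)%N -> c z ord0 i = 0)) ->
  tangent_in_chart V c y v -> rsubmx v = 0.
Proof.
move=> cV [gamma [e [e0 _ gammaV gammaC ->]]].
apply/rowP => j; rewrite !mxE derive1E.
have b0 : ball (0 : R) e 0 by exact: ballxx.
have dg : differentiable (c \o gamma) 0 by case: (gammaC 1) => + _; exact.
rewrite (derive_mx (diff_derivable dg)) mxE.
rewrite -[RHS](derive_cst (0 : R) (0 : R) (1 : R)).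
apply: near_eq_derive; apply/nbhs_ballP; exists e => // t /gammaV[ct Vt] /=.
by have /cV := Vt; apply => //=; rewrite leq_addr.
Qed.

Hypothesis FV : transverse F V.
Variables (c1 : chart R M n1) (c2 : chart R N (k + m)).
Variables (g : 'rV[R]_n1 -> 'rV[R]_(k + m)) (p : M).
Hypotheses (Ac1 : atlas c1) (Ac2 : atlas c2) (c1p : cdom c1 p).
Hypotheses (c2p : cdom c2 (F p)) (VFp : V (F p)) (gE : local_rep c1 c2 F g).
Hypothesis c2V : forall z, cdom c2 z ->
  (V z <-> forall i : 'I_(k + m), (k <= i)%N -> c2 z ord0 i = 0).

Lemma transverse_slice_row_full : row_full (rsubmx ('J g (c1 p))).
Proof.
rewrite -sub1mx; apply/row_subP => i.
(* Transversality splits this vector into an image under ['d g] and a tangent vector to [V]; the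
   latter has zero last block, so the former alone yields the basis vector. *)
have : [set: 'rV[R]_(k + m)] (row_mx 0 (row i 1%:M)) by [].
rewrite -(FV VFp Ac1 Ac2 c1p c2p gE) => -[_ [z _ <-]] [v vV uvE].
apply/submxP; exists z.
have := congr1 rsubmx uvE; rewrite row_mxKr => <-.
rewrite linearD /= (tangent_slice c2V vV) addr0.
have -> : 'd g (c1 p) z = z *m 'J g (c1 p) by rewrite mul_rV_lin1.
by rewrite -mulmx_rsub.
Qed.

End TransversePreimage.

(** A matrix with [n1] rows has rank [m]. The bound is what allows the source dimension to be
    written [d + m]. *)
Lemma transverse_codim_le (R : realType) (n1 k m : nat) (M : manifold R n1)
    (N : manifold R (k + m)) (F : M -> N) (V : set N) p :
  smooth_map F -> submanifold k V -> transverse F V -> V (F p) ->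
  (m <= n1)%N.
Proof.
move=> [_ FC] [_ Vs] FV VFp.
have [c2 [Ac2 c2p c2V]] := Vs _ VFp.
have [c1 Ac1 c1p] := atlas_cover p.
have [g _ gE] := FC _ _ Ac1 Ac2.
have := transverse_slice_row_full FV Ac1 Ac2 c1p c2p VFp gE c2V.
by rewrite /row_full => /eqP <-; exact: rank_leq_row.
Qed.

Lemma submanifold_preimage (R : realType) (d k m : nat)
    (M : manifold R (d + m)) (N : manifold R (k + m)) (F : M -> N)
    (V : set N) :
  smooth_map F -> submanifold k V -> transverse F V ->
  submanifold d (F @^-1` V).
Proof.
move=> [cF FC] [_ Vs] FV; split; first exact: leq_addr.
move=> p VFp; have [c2 [Ac2 c2p c2V]] := Vs _ VFp.
have [c1 Ac1 c1p] := atlas_cover p.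
have [g gC gE] := FC _ _ Ac1 Ac2.
set W := c1 @` _ in gC.
have oW : open W by exact: smooth_in_charts_domain_open.
have Wp : W (c1 p) by exists p.
have dg : differentiable g (c1 p) by case: (gC 1) => + _; exact.
pose h y := rsubmx (g y).
have hC : Cinfty W h.
  move=> j; apply/(Ck_coord _ _ oW) => i; rewrite /h.
  under eq_fun do rewrite mxE.
  exact: (proj1 (Ck_coord _ _ oW) (gC j)).
have hJ : 'J h (c1 p) = rsubmx ('J g (c1 p)).
  have dh : differentiable h (c1 p) by case: (hC 1) => + _; exact.
  apply/matrixP => i j; rewrite [RHS]mxE !jacobian_entry//.
  rewrite (derive_mx (diff_derivable dh)) (derive_mx (diff_derivable dg)) !mxE.
  have -> // : (fun t => h t ord0 j) = fun t => g t ord0 (rshift k j).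
  by apply/funext => t; rewrite /h mxE.
have [||c' [Ac' c'p c'W c'h]] := submersion_chart Ac1 c1p oW _ Wp hC.
- by move=> _ [x [c1x _] <-]; exists x.
- rewrite hJ.
  exact: (transverse_slice_row_full FV Ac1 Ac2 c1p c2p VFp gE c2V).
exists c'; split=> // x c'x.
(* Membership of [c1 x] in [W] only provides some point [x'] with the same coordinates; injectivity
   of [c1] identifies it with [x]. *)
have [c1x [x' [c1x' c2x'] x'x]] := c'W _ c'x.
have x'E := chart_inj c1x' c1x x'x; rewrite x'E in c2x'.
have E : rsubmx (c' x) = rsubmx (c2 (F x)) by rewrite c'h// /h gE.
(* The slice equations of [F^-1 V] in [c'] are thus those of [V] in [c2]. *)
have coordE (j : 'I_m) : c' x ord0 (rshift d j) = c2 (F x) ord0 (rshift k j).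
  by have := congr1 (fun u : 'rV_m => u ord0 j) E; rewrite !mxE.
split=> [/(c2V _ c2x') Vx i|c'0].
  case: (split_ordP i) => j -> => [/=|_]; first by rewrite leqNgt ltn_ord.
  by rewrite coordE Vx//= leq_addr.
apply/(c2V _ c2x') => i.
case: (split_ordP i) => j -> => [/=|_]; first by rewrite leqNgt ltn_ord.
by rewrite -coordE c'0//= leq_addr.
Qed.

(** * From manifolds to orbifolds *)

Lemma orb_chart_surj (R : realType) (X : topologicalType) (n : nat)
    (c : orb_chart R X n) : range c = odom c.
Proof.
have [h cE [_ _ <- _]] := oproj_homeo c.
rewrite cE; apply/seteqP; split=> [_ [x _ <-]|_ [z _ <-]].
  by exists (orbit_proj (oact c) x).
by exists (generic_quotient.repr z) => //=; rewrite /orbit_proj reprK.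
Qed.

Lemma orb_chart_fiber (R : realType) (X : topologicalType) (n : nat)
    (c : orb_chart R X n) x y : c x = c y -> exists g, oact c g x = y.
Proof.
have [h cE [_ hinj _ _]] := oproj_homeo c.
rewrite cE => /hinj; rewrite !inE => /(_ I I) /eqmodP /existsP[g /eqP gxy].
by exists g.
Qed.

Theorem theorem6p5 (R : realType) (n1 n2 k : nat)
    (O1 : orbifold R n1) (O2 : orbifold R n2) (f : O1 -> O2) (Q : set O2)
    (f_smooth : orb_smooth f) (Q_full : full_suborbifold k Q)
    (f_transverse : orb_transverse f k Q) :
  f @^-1` Q = set0 \/
  exists2 d : nat, d%:Z = n1%:Z - (n2%:Z - k%:Z) &
    full_suborbifold d (f @^-1` Q).
Proof.
(* A point of the preimage is what guarantees [m <= n1], so that the expected dimension is a natural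
   number. *)
have [[p0 Qp0]|P0] := pselect (f @^-1` Q !=set0); last first.
  by left; apply/seteqP; split=> // p Qp; apply: P0; exists p.
right.
have [m n2E] : exists m, n2 = (k + m)%N.
  by exists (n2 - k)%N; rewrite subnKC//; exact: Q_full.1.
subst n2.
have lift_nonempty (c : orb_chart R O1 n1) p : odom c p -> exists x, c x = p.
  by rewrite -orb_chart_surj => -[x _ <-]; exists x.
(* A point of [V] over [f (c1 x)] is in the orbit of [F x], so invariance puts [F x] itself in
   [V]. *)
have pre (c1 : orb_chart R O1 n1) (c2 : orb_chart R O2 (k + m)) V F :
    (forall g x, V x -> V (oact c2 g x)) -> c2 \o F = f \o c1 ->
    forall x, V (F x) <-> (c2 @` V) (f (c1 x)).
  move=> Vinv cF x; have cFx : c2 (F x) = f (c1 x) := congr1 (@^~ x) cF.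
  split=> [VFx|[v Vv]]; first by exists (F x).
  by rewrite -cFx => /orb_chart_fiber[g <-]; exact: Vinv.
have mn1 : (m <= n1)%N.
  have [c1 [c2 [V [F [_ [[_ c1p] _ [Vs Vinv [QV _]] [FC FV cF] _]]]]]] :=
    f_transverse _ Qp0.
  have [x xp] := lift_nonempty _ _ c1p.
  apply: (@transverse_codim_le _ _ _ _ _ _ F V x) => //.
  by apply/(pre _ _ _ _ Vinv cF); rewrite xp.
have [d n1E] : exists d, n1 = (d + m)%N by exists (n1 - m)%N; rewrite subnK.
subst n1; exists d; first by rewrite !PoszD; ring.
split; first exact: leq_addr.
move=> p Qp.
have [c1 [c2 [V [F [theta]]]]] := f_transverse _ Qp.
move=> [[Ac1 c1p] _ [Vs Vinv [QV [W oW WE]]] [FC FV cF] Ftheta].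
have FVE := pre _ _ _ _ Vinv cF.
exists c1, (setT_group (ogroup c1)), (F @^-1` V); split => //.
  split; first exact: submanifold_preimage.
    by move=> g x _ VFx; rewrite /preimage /= Ftheta; exact: Vinv.
  by move=> g x _ _; rewrite inE.
(* This exhibits the image as relatively open in the preimage of [Q], since [f] is continuous. *)
have E : c1 @` (F @^-1` V) = f @^-1` Q `&` (odom c1 `&` f @^-1` W).
  rewrite -orb_chart_surj; apply/seteqP; split.
    move=> _ [x /FVE + <-]; rewrite WE => -[Qx Wx].
    by split=> //; split=> //; exists x.
  move=> y [Qy [[x _ xy] Wy]]; exists x => //; apply/FVE.
  by rewrite xy WE.
split; last first.
  exists (odom c1 `&` f @^-1` W) => //; apply: openI; first exact: odom_open.
  by apply: open_comp => // x _; exact: f_smooth.1.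
by rewrite E; split=> //; split=> //; move: QV; rewrite WE => -[].
Qed.
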